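(* Fix $T>0$. Let $X,Y,M:[0,T)\times\Omega\to\mathbb R$ be real valued, non-negative (adapted) stochastic processes with $X(0)=0$, and let $0\le\tau<T$ be a stopping time such that $$\mathbb E\int_0^\tau MX\,ds<\infty .$$ Suppose that for some fixed constant $\kappa$, $$\int_0^\tau M\,ds<\kappa\quad\text{a.s.}$$ Suppose further that there is a constant $C_0$ such that for all stopping times $\tau_b$ with $0\le\tau_b\le\tau$, $$\mathbb E\Big(\sup_{t\in[0,\tau_b]}X+\int_0^{\tau_b}Y\,ds\Big)\le C_0\,\mathbb E\Big(X(0)+\int_0^{\tau_b}MX\,ds\Big),$$ where $C_0$ is independent of the choice of $\tau_b$. Then $$\mathbb E\sup_{t\in[0,\tau]}X=\mathbb E\int_0^\tau Y\,ds=0 .$$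
   Context: All processes and stopping times are relative to a filtered probability space $(\Omega,\mathcal F,\{\mathcal F_t\}_{t\ge0},\mathbb P)$ whose filtration is complete and right continuous; the processes $X,Y,M$ are jointly measurable and $\{\mathcal F_t\}$-adapted. Since $X(0)=0$, the term $X(0)$ on the right-hand side of the hypothesis vanishes. *)

(* Defs.v *)
From HB Require Import structures.
From mathcomp Require Import all_boot all_order all_algebra.
From mathcomp Require Import all_classical all_reals all_analysis.
Set Implicit Arguments.
Unset Strict Implicit.
Unset Printing Implicit Defensive.
Import Order.TTheory GRing.Theory Num.Theory.
Import numFieldNormedType.Exports.

Local Open Scope classical_set_scope.
Local Open Scope ring_scope.

(** Time is a real number; only the values of a filtration at times [t >= 0],
    and the values of a process at times [t] in [[0, T)], are constrained. *)

Section stochastic_processes.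
Context {R : realType} {d : measure_display} {Omega : measurableType d}.

Record filtration (F : R -> set (set Omega)) : Prop := Filtration {
  filtration_sigma_algebra : forall t, 0 <= t -> sigma_algebra setT (F t) ;
  filtration_measurable : forall t, 0 <= t -> F t `<=` measurable ;
  filtration_mono : forall s t, 0 <= s -> s <= t -> F s `<=` F t }.

Definition right_continuous_filtration (F : R -> set (set Omega)) : Prop :=
  forall t, 0 <= t -> F t = \bigcap_(s in [set s | t < s]) F s.

(** Every subset of a measurable [P]-null set belongs to [F 0]; for a
    filtration this forces the space [(Omega, P)] itself to be complete. *)
Definition complete_filtration (P : probability Omega R)
    (F : R -> set (set Omega)) : Prop :=
  P.-negligible `<=` F 0.

Definition stopping_time (F : R -> set (set Omega)) (tau : Omega -> R) : Prop :=
  (forall w, 0 <= tau w) /\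
  (forall t, 0 <= t -> F t [set w | tau w <= t]).

Record nonneg_adapted_process (F : R -> set (set Omega)) (T : R)
    (X : R -> Omega -> R) : Prop := NonnegAdaptedProcess {
  process_ge0 : forall t w, 0 <= t -> t < T -> 0 <= X t w ;
  process_measurable :
    measurable_fun (`[0, T[ `*` [set: Omega])
      (fun p : R * Omega => X p.1 p.2) ;
  process_adapted : forall t, 0 <= t -> t < T ->
    forall B : set R, measurable B -> F t (X t @^-1` B) }.

(** The pathwise supremum over [[0, t]], with values in [[0, +oo]]. It need not
    be Borel in [w], but over a complete space it is measurable, as an uncountable
    supremum of a jointly measurable process (measurable projection). *)
Definition running_sup (X : R -> Omega -> R) (t : R) (w : Omega) : \bar R :=
  ereal_sup [set (X s w)%:E | s in `[0, t]].

Definition time_integral (Y : R -> Omega -> R) (t : R) (w : Omega) : \bar R :=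
  (\int[@lebesgue_measure R]_(s in `[0%R, t]) (Y s w)%:E)%E.

End stochastic_processes.

(* Main.v *)
Require Import Defs.
From HB Require Import structures.
From mathcomp Require Import all_boot all_order all_algebra.
From mathcomp Require Import all_classical all_reals all_analysis.
From mathcomp Require Import measurable_realfun.
From mathcomp Require Import ring lra.
Set Implicit Arguments.
Unset Strict Implicit.
Unset Printing Implicit Defensive.
Import Order.TTheory GRing.Theory Num.Theory.
Import numFieldNormedType.Exports.

Local Open Scope classical_set_scope.
Local Open Scope ring_scope.

(** Let [A t] be the integral of [M] over [[0, t]] and, for [e] small against
    [1 / C0], let [sigma k] be the time at which [A] passes the level [k e],
    stopped at [tau]. Between [sigma k] and [sigma (k + 1)] the clock [A] gains at
    most [e], so the integral of [M X] over that interval is at most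
    [e * sup X]. If [M X] has zero integral up to [sigma k], the hypothesis at
    [sigma (k + 1)] bounds [E (int M X)] up to [sigma (k + 1)] by half of itself,
    hence it vanishes too. As [A tau < kappa], finitely many steps reach [tau].

    That [sigma k] is a stopping time needs [A t] to be measurable for the
    [t]-th sigma-algebra although [M] is only jointly measurable and adapted: a
    derandomized law of large numbers exhibits [A t] as an almost sure limit of
    finite combinations of values [M s], [s <= t]. *)

(** * Lower integrals and a criterion for almost sure convergence *)

Section lower_integral.
Context {d : measure_display} {T : measurableType d} {R : realType}
  (mu : {measure set T -> \bar R}).
Import HBNNSimple.
Local Open Scope ereal_scope.

(* The library integral of a nonnegative function is a supremum over simple
   functions, hence a lower integral when the function is not measurable, as may
   happen for [running_sup]. *)
Lemma ae_ge0_le_lower_integral (f g : T -> \bar R) :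
  (forall x, 0 <= f x) -> (forall x, 0 <= g x) ->
  {ae mu, forall x, f x <= g x} ->
  \int[mu]_x f x <= \int[mu]_x g x.
Proof.
move=> f0 g0 [N [mN N0 fgN]].
rewrite [leLHS]ge0_integralTE// [leRHS]ge0_integralTE//.
apply: ge_ereal_sup => _ [h hf <-].
have mNC : measurable (~` N) by exact: measurableC.
(* The simple function [h] is cut off to zero on the null set [N]: its integral is unchanged, and it
   then lies below [g] everywhere. *)
have -> : sintegral mu h = sintegral mu (proj_nnsfun h mNC).
  rewrite -!integralT_nnsfun; apply: ae_eq_integral => //.
  - exact/measurable_EFinP.
  - exact/measurable_EFinP.
  exists N; split => // x; apply: contra_notP => Nx _.
  by rewrite /= mindicE mem_set ?mulr1.
apply: ereal_sup_ubound; exists (proj_nnsfun h mNC) => // x /=.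
rewrite mindicE; have [|nNx] := boolP (x \in _).
  move/set_mem => Nx; rewrite mulr1; apply: le_trans (hf x) _.
  by apply: contrapT => fg; apply: Nx; exact: fgN.
by rewrite mulr0; exact: g0.
Qed.

(** A simple function below [k f], divided by [k], lies below [f]; the argument covers
    non-measurable functions such as the running supremum. *)
Lemma lower_integralZl (k : R) (f : T -> \bar R) :
  (0 < k)%R -> (forall x, 0 <= f x) ->
  \int[mu]_x (k%:E * f x) <= k%:E * \int[mu]_x f x.
Proof.
move=> k0 f0; rewrite ge0_integralTE; last first.
  by move=> x; rewrite mule_ge0// lee_fin ltW.
apply: ge_ereal_sup => _ [h hf <-]; rewrite -integralT_nnsfun.
rewrite -lee_pdivrMl// -ge0_integralZl//; last 3 first.
- exact/measurable_EFinP.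
- by move=> x _; rewrite lee_fin.
- by rewrite lee_fin invr_ge0 ltW.
apply: ae_ge0_le_lower_integral => //.
  by move=> x; rewrite -EFinM lee_fin mulr_ge0// invr_ge0 ltW.
by apply: aeW => x; rewrite lee_pdivrMl.
Qed.

End lower_integral.

(** The bounds are summable, so the series of squared errors has a finite integral. It converges
    almost everywhere, and there its terms tend to zero. *)
Lemma ae_cvg_geometric_sqr {R : realType} {d : measure_display}
    {T : measurableType d} (P : {measure set T -> \bar R})
    (u : nat -> T -> R) (g : T -> R) :
  (forall k, measurable_fun setT (u k)) -> measurable_fun setT g ->
  (forall k, \int[P]_w ((u k w - g w) ^+ 2)%:E <= (2 / (2 ^ (k + 1))%:R)%:E)%E ->
  {ae P, forall w, u ^~ w @ \oo --> g w}.
Proof.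
move=> mu mg ug; pose E k (w : T) : \bar R := ((u k w - g w) ^+ 2)%:E.
have E0 k w : (0 <= E k w)%E by rewrite lee_fin sqr_ge0.
have mE k : measurable_fun setT (E k).
  exact/measurable_EFinP/measurable_funX/measurable_funB.
have sumE0 w : (0 <= \sum_(0 <= k <oo) E k w)%E by apply: nneseries_ge0 => *.
have intE : P.-integrable setT (fun w => \sum_(0 <= k <oo) E k w)%E.
  apply/integrableP; split; first exact: ge0_emeasurable_sum.
  under eq_integral do rewrite gee0_abs//.
  rewrite integral_nneseries//.
  apply: (@le_lt_trans _ _ (2 / 2 ^+ 0 : R)%:E); last by rewrite ltry.
  have <- := cvg_lim (@ereal_hausdorff R) (@cvg_geometric_eseries_half _ (2 : R) 0).
  by apply: lee_nneseries => [i _ _|i _]; [exact: integral_ge0|exact: ug].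
have := integrable_ae measurableT intE.
apply: filterS => w /(_ I); rewrite ge0_fin_numE// => fin.
apply/cvgrPdist_lt => e e0.
(* The tail from [k] on dominates its first term, the squared error at [k], and is eventually below
   [e ^+ 2]. *)
have := nneseries_tail_cvg fin (fun k _ => E0 k w).
move=> /fine_cvgP[tail_fin /cvgrPdist_lt/(_ _ (exprn_gt0 2 e0)) tail].
near=> k.
rewrite -(@ltr_pXn2r _ 2)// ?nnegrE//; last exact: ltW.
rewrite real_normK ?num_real// -sqrrN opprB.
have tail_k : (\sum_(k <= i <oo) E i w \is a fin_num)%E by near: k.
rewrite -lte_fin; apply: (@le_lt_trans _ _ (\sum_(k <= i <oo) E i w)%E).
  have := @nneseries_lim_ge _ (fun i => E i w) xpredT k k.+1 (fun i _ _ => E0 i w).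
  by rewrite big_nat1.
rewrite -(fineK tail_k) lte_fin.
apply: le_lt_trans (ler_norm _) _; rewrite -normrN -sub0r.
by near: k.
Unshelve. all: by end_near.
Qed.

(** * Averages of adapted families are adapted *)

Section average.
Context {R : realType} {dS d : measure_display} {S : measurableType dS}
  {T : measurableType d} (mu : probability S R) (P : probability T R).

(** Centering [f] kills the cross term with [x], and a variable with values in [[0, 1]] has variance
    at most [1]. *)
Lemma integral_sqr_shift_le (f : S -> R) (x : R) :
  measurable_fun setT f -> (forall s, 0 <= f s <= 1) ->
  (\int[mu]_s ((x + (f s - \int[mu]_s f s)) ^+ 2)%:E <= (x ^+ 2 + 1)%:E)%E.
Proof.
move=> mf f01; set g := \int[mu]_s f s.
have intf : mu.-integrable setT (EFin \o f).
  apply: measurable_bounded_integrable => //.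
    by rewrite [X in (X < _)%E]probability_setT ltry.
  exists 1; split => // M M1 s _ /=.
  have /andP[f0 f1] := f01 s.
  by rewrite ger0_norm//; apply: le_trans f1 _; exact: ltW.
have fin : (\int[mu]_s (f s)%:E = g%:E)%E.
  by rewrite /g /Rintegral fineK//; exact: integrable_fin_num.
(* As [f ^+ 2 <= f], the square is at most an affine function of [f] with slope [c], whose integral
   is [x ^+ 2 + g - g ^+ 2]. *)
set c := 2 * (x - g) + 1.
apply: (@le_trans _ _
  (\int[mu]_s (((x - g) ^+ 2)%:E + c%:E * (f s)%:E))%E).
  have le_sqr s : (x + (f s - g)) ^+ 2 <= (x - g) ^+ 2 + c * f s.
    have -> : (x - g) ^+ 2 + c * f s = (x + (f s - g)) ^+ 2 + f s * (1 - f s).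
      by rewrite /c; ring.
    by have /andP[f0 f1] := f01 s; rewrite lerDl mulr_ge0// subr_ge0.
  apply: ae_ge0_le_lower_integral.
  - by move=> s; rewrite lee_fin sqr_ge0.
  - move=> s; rewrite -EFinM -EFinD lee_fin.
    by apply: le_trans (le_sqr s); exact: sqr_ge0.
  - by apply: aeW => s; rewrite -EFinM -EFinD lee_fin.
rewrite integralD//; last 2 first.
- exact: (finite_measure_integrable_cst _ ((x - g) ^+ 2)).
- exact: integrableZl.
have mu1 : mu setT = 1%E by exact: probability_setT.
rewrite integralZl// fin integral_cst// [X in (_ * X + _)%E]mu1 mule1.
rewrite -EFinM -EFinD lee_fin /c.
have : 0 <= (g - 2^-1) ^+ 2 by exact: sqr_ge0.
nra.
Qed.

Variables (f : S * T -> R) (G : set (set T)).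
Hypotheses (mf : measurable_fun setT f) (f01 : forall z, 0 <= f z <= 1)
  (G_sigma : sigma_algebra setT G) (G_measurable : G `<=` measurable)
  (G_complete : P.-negligible `<=` G)
  (fG : forall s B, measurable B -> G ((fun w => f (s, w)) @^-1` B)).
(** The space [T] with [G] as its sigma-algebra, so that [measurable_fun] on it expresses
    measurability with respect to [G]. *)
Local Notation GT := (g_sigma_algebraType G).
Local Notation g := (fun w => \int[mu]_s f (s, w)).

Let mg : measurable_fun setT g.
Proof.
apply: (@measurableT_comp _ _ _ _ _ _ (@fine R)) => //.
apply: (measurable_fun_fubini_tonelli_G (EFin \o f)) => //.
  exact/measurable_EFinP.
by move=> z; rewrite lee_fin; have /andP[] := f01 z.
Qed.

Let measurable_G (h : GT -> R) :
  measurable_fun setT h -> measurable_fun setT (h : T -> R).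
Proof.
move=> mh _ B mB; apply: G_measurable.
by have := mh measurableT B mB; rewrite measurable_g_measurableTypeE.
Qed.

(* Averaged over [s], adding [f (s, _) - g] to [h - n g] increases the second
   moment by at most [1], so some [s] increases it by less than [2]; this gives
   sums of [n] values of [f] without building an infinite product space. *)
Lemma adapted_sum_approximates_average (n : nat) :
  exists2 h : GT -> R, measurable_fun setT h &
    (\int[P]_w ((h w - n%:R * g w) ^+ 2)%:E <= (2 * n%:R)%:E)%E.
Proof.
elim: n => [|n [h mh hn]].
  exists (cst 0); first exact: measurable_cst.
  by under eq_integral do rewrite mul0r subr0 expr0n/=; rewrite integral0 mulr0.
have mhT := measurable_G mh.
pose D (w : T) : R := h w - n%:R * g w.
pose F (z : S * T) : \bar R := ((D z.2 + (f z - g z.2)) ^+ 2)%:E.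
have mD : measurable_fun setT D.
  by apply: measurable_funB => //; apply: measurable_funM.
have mF : measurable_fun setT F.
  apply/measurable_EFinP/measurable_funX/measurable_funD.
    exact: (measurableT_comp mD).
  by apply: measurable_funB => //; exact: (measurableT_comp mg).
have F0 z : (0 <= F z)%E by rewrite lee_fin sqr_ge0.
have [s Fs] : exists s, (\int[P]_w F (s, w) <= (2 * n.+1%:R)%:E)%E.
  (* If every [s] failed, the average over [s] would be at least [2 (n + 1)], whereas Tonelli and
     the shift estimate bound it by [2 n + 1]. *)
  apply: contrapT => /forallNP Fs.
  have : ((2 * n.+1%:R)%:E <= \int[mu]_s \int[P]_w F (s, w))%E.
    have -> : (2 * n.+1%:R)%:E = (\int[mu]_s cst (2 * n.+1%:R : R)%:E s)%E.
      by rewrite integral_cst// [X in (_ * X)%E]probability_setT mule1.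
    apply: ae_ge0_le_lower_integral => [s|s|].
    - by rewrite lee_fin mulr_ge0.
    - exact: integral_ge0.
    - by apply: aeW => s; rewrite leNgt; apply/negP => /ltW/Fs.
  apply/negP; rewrite -ltNge fubini_tonelli//.
  apply: (@le_lt_trans _ _ (2 * n%:R + 1)%:E); last first.
    by rewrite lte_fin -natr1; lra.
  apply: (@le_trans _ _ (\int[P]_w ((D w ^+ 2)%:E + cst 1 w))%E).
    apply: ae_ge0_le_lower_integral => [w|w|].
    - exact: integral_ge0.
    - by rewrite adde_ge0// lee_fin sqr_ge0.
    - apply: aeW => w.
      have mfw : measurable_fun setT (fun s => f (s, w)).
        exact: measurable_fun_pair1.
      have := integral_sqr_shift_le (D w) mfw (fun s => f01 (s, w)).
      by rewrite EFinD.
  rewrite ge0_integralD//; last 2 first.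
  - by move=> w _; rewrite lee_fin sqr_ge0.
  - exact/measurable_EFinP/measurable_funX.
  by rewrite integral_cst// [X in (_ * X)%E]probability_setT mule1 EFinD leeD2r.
exists (fun w => h w + f (s, w)).
  apply: measurable_funD => // _ B mB.
  by rewrite setTI measurable_g_measurableTypeE//; exact: fG.
apply: le_trans Fs; rewrite le_eqVlt; apply/orP; left; apply/eqP.
apply: eq_integral => w _; rewrite /F/D/=; congr (_ ^+ 2)%:E.
by rewrite mulrS; ring.
Qed.

(** Dividing the sums of [n] values by [n] leaves a mean square error of at most [2 / n], which is
    summable along [n = 2 ^ (k + 1)]. So [g] is an almost sure limit of [G]-measurable functions,
    and [G] contains the negligible sets. *)
Lemma average_adapted (B : set R) : measurable B -> G (g @^-1` B).
Proof.
move=> mB.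
have [h /all_and2[mh hg]] := choice (fun k =>
  let: ex_intro2 h mh hg := adapted_sum_approximates_average (2 ^ (k + 1)) in
  ex_intro (fun h : GT -> R => measurable_fun setT h /\
    (\int[P]_w ((h w - (2 ^ (k + 1))%:R * g w) ^+ 2)%:E
      <= (2 * (2 ^ (k + 1))%:R)%:E)%E) h (conj mh hg)).
pose u k (w : T) : R := (2 ^ (k + 1))%:R^-1 * h k w.
have mu_ k : measurable_fun setT (u k : GT -> R) by apply: measurable_funM.
have [] : {ae P, forall w, u ^~ w @ \oo --> g w}.
  apply: ae_cvg_geometric_sqr => // [k|k]; first exact: measurable_G.
  set c : R := (2 ^ (k + 1))%:R.
  have c0 : 0 < c by rewrite ltr0n expn_gt0.
  under eq_integral => w _.
    rewrite (_ : ((u k w - g w) ^+ 2)%:E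
      = ((c^-1 ^+ 2)%:E * ((h k w - c * g w) ^+ 2)%:E)%E); last first.
      by rewrite -EFinM -exprMn mulrBr mulrA mulVf ?gt_eqF// mul1r.
    over.
  rewrite ge0_integralZl//; last 3 first.
  - apply/measurable_EFinP/measurable_funX/measurable_funB; first exact: measurable_G.
    by apply: measurable_funM.
  - by move=> w _; rewrite lee_fin sqr_ge0.
  - by rewrite lee_fin sqr_ge0.
  rewrite -lee_pdivlMl ?exprn_gt0 ?invr_gt0//.
  apply: le_trans (hg k) _; rewrite -EFinM lee_fin -/c.
  by rewrite le_eqVlt; apply/orP; left; apply/eqP; field; rewrite gt_eqF.
move=> N [mN N0 cvgN].
have GN A : A `<=` N -> G A.
  by move=> AN; apply: G_complete; exists N; split.
have GU A1 A2 : G A1 -> G A2 -> G (A1 `|` A2).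
  rewrite -(measurable_g_measurableTypeE G_sigma); exact: measurableU.
(* Within [N] the preimage is negligible, hence in [G]. Off [N], [g] is the limit of the [u k];
   cutting both to zero on [N] makes the convergence hold everywhere. *)
rewrite -(setIT (g @^-1` B)) -(setUv N) setIUr.
apply: GU; first by apply: GN => w [].
pose v k (w : GT) : R := u k w * \1_(~` N) w.
have mNC : measurable (~` N : set GT).
  rewrite measurable_g_measurableTypeE// -setTD.
  by have [_ GC _] := G_sigma; apply: GC; exact: GN.
have mg' : measurable_fun setT (fun w : GT => g w * \1_(~` N) w).
  apply: (@measurable_fun_cvg _ _ _ _ v) => [k|w _].
    by apply: measurable_funM => //; exact: measurable_indic.
  rewrite /v indicE; have [/set_mem Nw|_] := boolP (w \in ~` N).
    rewrite mulr1; under eq_fun do rewrite mulr1.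
    by apply: contrapT => /cvgN.
  rewrite mulr0; under eq_fun do rewrite mulr0.
  exact: cvg_cst.
have := measurableI _ _ (mg' measurableT B mB) mNC.
rewrite measurable_g_measurableTypeE// setTI.
congr (G _); apply/seteqP; split => w [Bw Nw]; split => //; last first.
  by rewrite /preimage/= indicE mem_set// mulr1.
by move: Bw; rewrite /preimage/= indicE mem_set// mulr1.
Qed.

End average.

(** * The time integral of a process: continuity, measurability, adaptedness *)

Section time_integrals.
Context {R : realType} {d : measure_display} {Omega : measurableType d}
  {F : R -> set (set Omega)} {T : R} {M : R -> Omega -> R}.
Hypothesis M_process : nonneg_adapted_process F T M.

Lemma process_extension_measurable : measurable_fun setT
  ((fun p : R * Omega => M p.1 p.2) \_ (`[0, T[ `*` [set: Omega])).
Proof.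
apply: (iffLR (measurable_restrictT _ _)); first exact: measurableX.
exact: process_measurable M_process.
Qed.

Lemma process_path_measurable (t : R) (w : Omega) : t < T ->
  measurable_fun `[0, t] (M ^~ w).
Proof.
move=> tT; apply: (@eq_measurable_fun _ _ _ _ _ (fun s =>
  ((fun p : R * Omega => M p.1 p.2) \_ (`[0, T[ `*` [set: Omega])) (s, w))).
  move=> s; rewrite inE/= in_itv/= => /andP[s0 st].
  by rewrite patchE mem_set//; split => //=; rewrite in_itv/= s0 (le_lt_trans st).
apply: measurable_funTS.
exact: (measurable_fun_pair1 w process_extension_measurable).
Qed.

Lemma time_integral_ge0 (t : R) (w : Omega) : t < T ->
  (0 <= time_integral M t w)%E.
Proof.
move=> tT; apply: integral_ge0 => s; rewrite /= in_itv/= => /andP[s0 st].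
by rewrite lee_fin (process_ge0 M_process)// (le_lt_trans st).
Qed.

Lemma time_integral0 (w : Omega) : time_integral M 0 w = 0%E.
Proof. by rewrite /time_integral set_itv1 integral_set1. Qed.

Lemma time_integral_split (s t : R) (w : Omega) : 0 <= s -> s <= t -> t < T ->
  time_integral M t w = (time_integral M s w +
    \int[@lebesgue_measure R]_(r in `]s, t]) (M r w)%:E)%E.
Proof.
move=> s0 st tT; rewrite /time_integral.
have itvU : `[0, t]%classic = `[0, s]%classic `|` `]s, t]%classic.
  by rewrite -itv_bndbnd_setU// bnd_simp.
rewrite itvU ge0_integral_setU//.
- by rewrite -itvU; apply/measurable_EFinP; exact: process_path_measurable.
- rewrite -itvU => r; rewrite /= in_itv/= => /andP[r0 rt].
  by rewrite lee_fin (process_ge0 M_process)// (le_lt_trans rt).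
- apply/disj_set2P; rewrite -subset0 => r [/=].
  by rewrite !in_itv/= => /andP[_ rs] /andP[/lt_geF]; rewrite rs.
Qed.

Lemma le_time_integral (s t : R) (w : Omega) : 0 <= s -> s <= t -> t < T ->
  (time_integral M s w <= time_integral M t w)%E.
Proof.
move=> s0 st tT; rewrite (time_integral_split _ s0 st tT) leeDl//.
apply: integral_ge0 => r; rewrite /= in_itv/= => /andP[sr rt].
rewrite lee_fin (process_ge0 M_process)//.
  exact: le_trans (ltW sr).
exact: le_lt_trans tT.
Qed.

Lemma time_integral_fin_num (s t : R) (w : Omega) : 0 <= s -> s <= t -> t < T ->
  (time_integral M t w < +oo)%E -> time_integral M s w \is a fin_num.
Proof.
move=> s0 st tT Mt; rewrite ge0_fin_numE; last exact/time_integral_ge0/(le_lt_trans st).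
exact: le_lt_trans (le_time_integral _ s0 st tT) Mt.
Qed.

(** Finiteness at [t] makes the path integrable on [[0, t]], and the integral of an integrable
    function is continuous in its end point. *)
Lemma time_integral_continuous (t x e : R) (w : Omega) : t < T ->
  (time_integral M t w < +oo)%E -> 0 <= x <= t -> 0 < e ->
  exists2 r, 0 < r & forall y, 0 <= y <= t -> `|x - y| < r ->
    `|fine (time_integral M x w) - fine (time_integral M y w)| < e.
Proof.
move=> tT Mt xt e0; have [x0 x_le_t] := andP xt.
have intM : (@lebesgue_measure R).-integrable `[0, t] (EFin \o M ^~ w).
  apply/integrableP; split.
    by apply/measurable_EFinP; exact: process_path_measurable.
  apply: le_lt_trans Mt; rewrite le_eqVlt; apply/orP; left; apply/eqP.
  apply: eq_integral => s; rewrite inE/= in_itv/= => /andP[s0 st].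
  by rewrite ger0_norm// (process_ge0 M_process)// (le_lt_trans st).
have := parameterized_integral_continuous (le_trans x0 x_le_t) intM.
move=> /subspace_continuousP/(_ x)/= cont.
have {cont} := cont _; rewrite in_itv/= => /(_ xt).
move=> /cvgrPdist_lt/(_ e e0).
rewrite /within/= => -[r /= r0 cont].
by exists r => // y yt xy; apply: cont => //=; rewrite in_itv.
Qed.

(** The random upper limit is moved into the integrand: [M] restricted to the region below the graph
    of [sigma] is jointly measurable, and Tonelli applies. *)
Lemma measurable_time_integral (sigma : Omega -> R) :
  measurable_fun setT sigma -> (forall w, 0 <= sigma w < T) ->
  measurable_fun setT (fun w => time_integral M (sigma w) w).
Proof.
move=> msigma sigmaT.
pose E := [set p : R * Omega | p.1 <= sigma p.2].
pose f := (fun p : R * Omega => (M p.1 p.2)%:E) \_ ((`[0, T[ `*` setT) `&` E).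
have mE : measurable E.
  have mh : measurable_fun setT (fun p : R * Omega => sigma p.2 - p.1).
    by apply: measurable_funB => //; exact: (measurableT_comp msigma).
  have := mh measurableT _ (measurable_itv `[0, +oo[).
  rewrite setTI; congr measurable; apply/seteqP.
  by split => p; rewrite /E/= in_itv/= andbT subr_ge0.
have mf : measurable_fun setT f.
  apply: (iffLR (measurable_restrictT _ _)).
    by apply: measurableI => //; exact: measurableX.
  apply/measurable_EFinP; apply: measurable_funS (process_measurable M_process).
    exact: measurableX.
  by move=> p [].
have f0 z : (0 <= f z)%E.
  rewrite /f patchE; case: ifPn => // /set_mem[[/= + _] _].
  by rewrite in_itv/= lee_fin => /andP[z0 zT]; exact: (process_ge0 M_process).
have := measurable_fun_fubini_tonelli_G (m1 := @lebesgue_measure R) f mf f0.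
apply: eq_measurable_fun => w _; rewrite /fubini_G /time_integral.
rewrite [RHS]integral_mkcond; apply: eq_integral => s _.
rewrite /f !patchE; congr (if _ then _ else _).
have /andP[_ sT] := sigmaT w.
apply/idP/idP => /set_mem/=; rewrite /E/= ?in_itv/=.
  by move=> [[/andP[s0 _] _] st]; rewrite mem_set//= in_itv/= s0.
by move=> /andP[s0 st]; rewrite mem_set//=; do 2 split=> //=;
  rewrite in_itv/= s0 (le_lt_trans st).
Qed.

Hypotheses (F_filtration : filtration F) (P : probability Omega R)
  (F_complete : complete_filtration P F).

(** Truncated at [c = n + 1] and divided by [c], the process has values in [[0, 1]]. Its average
    under the uniform law on [[0, t]] is the truncated integral over [t c], so [average_adapted]
    applies with [G = F t]. *)
Lemma truncated_integral_adapted (t : R) (n : nat) (u : R) : 0 < t -> t < T ->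
  F t [set w | (\int[@lebesgue_measure R]_(s in `[0%R, t])
                  (Num.min (M s w) n.+1%:R)%:E <= u%:E)%E].
Proof.
move=> t0 tT.
have c0 : 0 < n.+1%:R :> R by rewrite ltr0n.
set c : R := n.+1%:R in c0 *.
have tge0 := ltW t0.
pose f := (fun p : R * Omega => Num.min (M p.1 p.2) c / c)
  \_ (`[0, t] `*` [set: Omega]).
have f_in s w : s \in `[0, t] -> f (s, w) = Num.min (M s w) c / c.
  by move=> st; rewrite /f patchE mem_set.
have f_out s w : s \notin `[0, t] -> f (s, w) = 0.
  move=> st; rewrite /f patchE memNset//= => -[/= + _].
  by rewrite (negbTE st).
have mf : measurable_fun setT f.
  apply: (iffLR (measurable_restrictT _ _)); first exact: measurableX.
  apply: measurable_funM => //; apply: measurable_minr => //.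
  apply: measurable_funS (process_measurable M_process); first exact: measurableX.
  move=> [s w] [/= + _]; rewrite !in_itv/= => /andP[s0 st]; split => //=.
  by rewrite s0 (le_lt_trans st).
have f01 z : 0 <= f z <= 1.
  case: z => s w; have [st|/f_out->] := boolP (s \in `[0, t]); last first.
    by rewrite lexx ler01.
  rewrite f_in//; move: st; rewrite in_itv/= => /andP[s0 st].
  apply/andP; split; last by rewrite ler_pdivrMr// mul1r ge_min lexx orbT.
  apply: divr_ge0; last exact: ltW.
  by rewrite le_min (process_ge0 M_process) ?(le_lt_trans st)//= ltW.
have fF s B : measurable B -> F t ((fun w => f (s, w)) @^-1` B).
  move=> mB; have [st|st] := boolP (s \in `[0, t]); last first.
    rewrite (_ : (fun w => f (s, w)) = cst 0); last by apply/funext => w; exact: f_out.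
    rewrite preimage_cst -(measurable_g_measurableTypeE
      (filtration_sigma_algebra F_filtration tge0)).
    by case: ifP.
  rewrite (_ : _ @^-1` B = M s @^-1` ((fun x => Num.min x c / c) @^-1` B)); last first.
    by apply/seteqP; split => w /=; rewrite f_in.
  move: st; rewrite in_itv/= => /andP[s0 st].
  apply: (filtration_mono F_filtration s0 st).
  apply: (process_adapted M_process) => //; first exact: le_lt_trans tT.
  rewrite -[X in measurable X]setTI.
  apply: (measurable_funM _ (measurable_cst _)) => //.
  by apply: measurable_minr.
pose I w := (\int[@lebesgue_measure R]_(s in `[0%R, t]) (Num.min (M s w) c)%:E)%E.
have mmin w : measurable_fun `[0, t] (fun s => (Num.min (M s w) c)%:E).
  by apply/measurable_EFinP/measurable_minr => //; exact: process_path_measurable.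
have min_ge0 w s : `[0, t]%classic s -> (0 <= (Num.min (M s w) c)%:E)%E.
  rewrite /= in_itv/= => /andP[s0 st]; rewrite lee_fin le_min.
  by rewrite (process_ge0 M_process) ?(le_lt_trans st)//= ltW.
have I_fin w : I w \is a fin_num.
  rewrite ge0_fin_numE; last by apply: integral_ge0; exact: min_ge0.
  apply: (@le_lt_trans _ _ (\int[@lebesgue_measure R]_(s in `[0%R, t]) cst c%:E s)%E).
    apply: ge0_le_integral => //; [exact: min_ge0|exact: mmin|].
    by move=> s _; rewrite lee_fin ge_min lexx orbT.
  by rewrite integral_cst// [X in (_ * X)%E]lebesgue_measure_itv/= lte_fin t0
    oppr0 addr0 -EFinM ltry.
have average_f w : \int[uniform_prob t0]_s f (s, w) = fine (I w) / (t * c).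
  rewrite /Rintegral integral_uniform; last 2 first.
  - by apply/measurable_EFinP; exact: measurable_fun_pair1.
  - by move=> s; rewrite lee_fin; have /andP[] := f01 (s, w).
  rewrite subr0.
  rewrite [X in fine (_ * X)](_ : _ = (c^-1%:E * I w)%E); last first.
    rewrite -[RHS]ge0_integralZl//.
    - apply: eq_integral => s; rewrite inE => st.
      by rewrite f_in// mulrC EFinM.
    - exact: mmin.
    - exact: min_ge0.
    - by rewrite lee_fin invr_ge0 ltW.
  by rewrite -(fineK (I_fin w)) -!EFinM/=; field; rewrite ?gt_eqF.
have := average_adapted (uniform_prob t0) mf f01
  (filtration_sigma_algebra F_filtration tge0)
  (filtration_measurable F_filtration tge0)
  (subset_trans F_complete (filtration_mono F_filtration (lexx 0) tge0)) fF.
move=> /(_ _ (measurable_itv `]-oo, (u / (t * c))])).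
congr (F t _); apply/seteqP; split => w /=.
  by rewrite in_itv/= average_f ler_pM2r ?invr_gt0 ?mulr_gt0// -lee_fin fineK.
by rewrite in_itv/= average_f ler_pM2r ?invr_gt0 ?mulr_gt0// -lee_fin fineK.
Qed.

(** By monotone convergence in the truncation level, the integral is at most [u] exactly when all
    truncated integrals are; this includes paths with an infinite integral. *)
Lemma time_integral_adapted (t : R) (u : R) : 0 < t -> t < T ->
  F t [set w | (time_integral M t w <= u%:E)%E].
Proof.
move=> t0 tT.
pose m n w s : \bar R := (Num.min (M s w) n.+1%:R)%:E.
have M0 w s : `[0, t]%classic s -> 0 <= M s w.
  rewrite /= in_itv/= => /andP[s0 st].
  by rewrite (process_ge0 M_process) ?(le_lt_trans st).
have mM w := process_path_measurable w tT.
have mm n w : measurable_fun `[0, t] (m n w).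
  by apply/measurable_EFinP/measurable_minr.
have m0 w n s : `[0, t]%classic s -> (0 <= m n w s)%E.
  by move=> st; rewrite lee_fin le_min M0//=.
rewrite (_ : [set w | _] = \bigcap_n [set w |
  (\int[@lebesgue_measure R]_(s in `[0%R, t]) m n w s <= u%:E)%E]).
  rewrite -(measurable_g_measurableTypeE
    (filtration_sigma_algebra F_filtration (ltW t0))).
  apply: bigcapT_measurable => n.
  rewrite measurable_g_measurableTypeE; first exact: truncated_integral_adapted.
  exact: (filtration_sigma_algebra F_filtration (ltW t0)).
apply/seteqP; split => w /=.
  move=> Mu n _; apply: le_trans Mu; apply: ge0_le_integral => //.
  - exact: m0.
  - exact: mm.
  - by apply/measurable_EFinP; exact: mM.
  - by move=> s _; rewrite lee_fin ge_min lexx.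
move=> mu; rewrite /time_integral.
have nd_m s : `[0, t]%classic s ->
    {homo (fun n => m n w s) : a b / (a <= b)%N >-> (a <= b)%E}.
  move=> _ a b ab; rewrite lee_fin le_min ge_min lexx/= ge_min.
  by rewrite ler_nat ltnS ab orbT.
have := @cvg_monotone_convergence _ _ _ (@lebesgue_measure R) _
  (measurable_itv `[0, t]) (fun n => m n w) (fun n => mm n w) (fun n => m0 w n) nd_m.
rewrite [X in _ --> X](_ : _ = \int[@lebesgue_measure R]_(s in `[0%R, t]) (M s w)%:E)%E.
  by apply: cvge_le; apply: nearW => n; exact: mu.
apply: eq_integral => s; rewrite inE => st.
apply/cvg_lim => //; apply: cvg_near_cst.
near=> n.
rewrite /m; congr EFin; apply/min_idPl.
apply: (@le_trans _ _ n%:R); last by rewrite ler_nat.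
by near: n; exact: nbhs_infty_ger.
Unshelve. all: by end_near.
Qed.

End time_integrals.

(** * Passage times of the clock and their stopping property *)

Section first_passage.
Context {R : realType} {d : measure_display} {Omega : measurableType d}
  {F : R -> set (set Omega)} {T : R} {M : R -> Omega -> R} {tau : Omega -> R}.
Hypotheses (M_process : nonneg_adapted_process F T M)
  (tau_stopping : stopping_time F tau) (tau_lt_T : forall w, tau w < T).

(** Taking a supremum over [[0, tau w]] builds in the stopping at [tau]: the value is [tau w] if the
    level is never exceeded. For [u >= 0] the set contains [0]. *)
Definition passage_time (u : R) (w : Omega) : R :=
  sup [set s | 0 <= s <= tau w /\ (time_integral M s w <= u%:E)%E].

Section level.
Context {u : R} (u_ge0 : 0 <= u).

Lemma passage_time_has_sup (w : Omega) :
  has_sup [set s | 0 <= s <= tau w /\ (time_integral M s w <= u%:E)%E].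
Proof.
split; last by exists (tau w) => s [/andP[]].
exists 0; split; last by rewrite time_integral0 lee_fin.
by have [tau0 _] := tau_stopping; rewrite lexx tau0.
Qed.

Lemma passage_time_ge (s : R) (w : Omega) : 0 <= s <= tau w ->
  (time_integral M s w <= u%:E)%E -> s <= passage_time u w.
Proof.
by move=> st Mu; apply: ub_le_sup => //; have [] := passage_time_has_sup w.
Qed.

Lemma passage_time_ge0 (w : Omega) : 0 <= passage_time u w.
Proof.
apply: passage_time_ge; last by rewrite time_integral0 lee_fin.
by have [tau0 _] := tau_stopping; rewrite lexx tau0.
Qed.

Lemma passage_time_le (w : Omega) : passage_time u w <= tau w.
Proof.
by apply: ge_sup => [|s [/andP[]]//]; have [] := passage_time_has_sup w.
Qed.

Lemma before_passage_time (s : R) (w : Omega) : 0 <= s -> s < passage_time u w ->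
  (time_integral M s w <= u%:E)%E.
Proof.
move=> s0 su; have [r [/andP[r0 rt] Mr] sr] := sup_gt (passage_time_has_sup w).1 su.
apply: le_trans Mr.
apply: (le_time_integral M_process) => //; first exact: ltW.
exact: le_lt_trans (tau_lt_T w).
Qed.

Lemma after_passage_time (s : R) (w : Omega) : passage_time u w < s -> s <= tau w ->
  (u%:E < time_integral M s w)%E.
Proof.
move=> us st; rewrite ltNge; apply/negP => Mu.
have := passage_time_ge _ Mu; rewrite st (le_trans (passage_time_ge0 w) (ltW us)).
by move=> /(_ isT); rewrite leNgt us.
Qed.

Hypotheses (F_filtration : filtration F)
  (F_right_continuous : right_continuous_filtration F)
  (P : probability Omega R) (F_complete : complete_filtration P F).

(* The clock may jump to [+oo], so [passage_time u w <= t] is not decided by the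
   clock at [t]; it is decided just after [t], hence the right continuity. *)
Lemma passage_time_stopping : stopping_time F (passage_time u).
Proof.
split; first exact: passage_time_ge0.
move=> t t0; rewrite F_right_continuous// => r /= tr.
have r0 : 0 <= r by apply: le_trans (ltW tr).
have Fr := filtration_sigma_algebra F_filtration r0.
(* These times decrease from [r] to [t] and stay strictly above [t], so events at time [s n] belong
   to [F r]. *)
pose s n := t + (r - t) * n.+1%:R^-1.
have ts n : t < s n by rewrite ltrDl mulr_gt0// ?subr_gt0// invr_gt0.
have s0 n : 0 <= s n by apply: le_trans (ltW (ts n)).
have sr n : s n <= r.
  by rewrite -lerBrDl ger_pMr ?subr_gt0// invf_le1// ler1n.
(* The passage time exceeds [t] exactly when, at some [s n] before [tau], the clock is still at most
   [u]. *)
rewrite (_ : [set w | _] = ~` \bigcup_n ([set w | s n < tau w] `&`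
    [set w | (time_integral M (s n) w <= u%:E)%E])).
  rewrite -(measurable_g_measurableTypeE Fr); apply: measurableC.
  apply: bigcupT_measurable => n; rewrite measurable_g_measurableTypeE//.
  have [sT|Ts] := ltP (s n) T; last first.
    rewrite [X in X `&` _](_ : _ = set0); last first.
      apply/seteqP; split => w //=; rewrite ltNge => /negP; apply.
      exact: ltW (lt_le_trans (tau_lt_T w) Ts).
    by rewrite set0I; have [] := Fr.
  apply: (filtration_mono F_filtration (s0 n) (sr n)).
  have Fs := filtration_sigma_algebra F_filtration (s0 n).
  rewrite -(measurable_g_measurableTypeE Fs); apply: measurableI.
    rewrite (_ : [set w | _] = ~` [set w | tau w <= s n]); last first.
      by apply/seteqP; split => w /=; rewrite ltNge => /negP.
    apply: measurableC; rewrite measurable_g_measurableTypeE//.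
    by have [_] := tau_stopping; exact.
  rewrite measurable_g_measurableTypeE//.
  apply: (time_integral_adapted M_process F_filtration F_complete _ _ sT).
  exact: le_lt_trans (ts n).
apply/seteqP; split => w /=.
  move=> ut [n _ [/= st Mu]].
  have := passage_time_ge _ Mu; rewrite s0 (ltW st) => /(_ isT).
  by rewrite leNgt (le_lt_trans ut (ts n)).
apply: contra_notP => /negP; rewrite -ltNge => tu.
have e0 : 0 < (passage_time u w - t) / (r - t) by rewrite divr_gt0// subr_gt0.
have [n /=] := filter_ex (near_infty_natSinv_lt (PosNum e0)).
rewrite ltr_pdivlMr ?subr_gt0// mulrC -[_ * _ < _](ltrD2l t) subrKC => sn.
exists n => //; split; last exact: before_passage_time.
exact: lt_le_trans sn (passage_time_le w).
Qed.

Section finite_path.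
Context {w : Omega} (M_fin : (time_integral M (tau w) w < +oo)%E).

(** On a path with finite integral the clock is continuous: were it above [u] at the passage time,
    it would be above [u] shortly before. *)
Lemma time_integral_passage_time_le :
  (time_integral M (passage_time u w) w <= u%:E)%E.
Proof.
set x := passage_time u w; have x0 : 0 <= x := passage_time_ge0 w.
have xt : x <= tau w := passage_time_le w.
have fin s : 0 <= s -> s <= tau w -> time_integral M s w \is a fin_num.
  by move=> s0 st; exact: (time_integral_fin_num M_process s0 st (tau_lt_T w) M_fin).
rewrite leNgt; apply/negP => ux.
have e0 : 0 < fine (time_integral M x w) - u.
  by rewrite subr_gt0 -lte_fin fineK// fin.
have [|r r0 cont] :=
  time_integral_continuous M_process (tau_lt_T w) M_fin _ e0 (x := x).
  by rewrite x0.
have x_gt0 : 0 < x.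
  rewrite lt_neqAle x0 andbT; apply: contraTneq ux => <-.
  by rewrite time_integral0 lte_fin -leNgt.
(* The maximum keeps [y] in [[0, tau w]]; it is below [x] because [x > 0], the clock being [0] at
   time [0]. *)
pose y := Num.max 0 (x - r / 2).
have y0 : 0 <= y by rewrite le_max lexx.
have yx : y < x by rewrite gt_max x_gt0 ltrBlDr ltrDl divr_gt0.
have My := before_passage_time y0 yx.
have := cont y; rewrite y0 (le_trans (ltW yx) xt) => /(_ isT).
rewrite ger0_norm ?subr_ge0 ?ltW// ltrBlDl -ltrBlDr.
have -> : x - r < y.
  by rewrite lt_max ltrD2l ltrN2 ltr_pdivrMr// mulr_natr mulr2n ltrDl r0 orbT.
move=> /(_ isT); rewrite ltr_norml => /andP[_]; rewrite ltrD2l ltrN2.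
by rewrite ltNge -lee_fin fineK ?My// fin// (le_trans (ltW yx)).
Qed.

(** Were the clock below [u] at a passage time before [tau], continuity would keep it below [u]
    shortly after. *)
Lemma le_time_integral_passage_time : passage_time u w < tau w ->
  (u%:E <= time_integral M (passage_time u w) w)%E.
Proof.
set x := passage_time u w; have x0 : 0 <= x := passage_time_ge0 w.
move=> xt.
have fin s : 0 <= s -> s <= tau w -> time_integral M s w \is a fin_num.
  by move=> s0 st; exact: (time_integral_fin_num M_process s0 st (tau_lt_T w) M_fin).
rewrite leNgt; apply/negP => ux.
have e0 : 0 < u - fine (time_integral M x w).
  by rewrite subr_gt0 -lte_fin fineK// fin// ltW.
have [|r r0 cont] :=
  time_integral_continuous M_process (tau_lt_T w) M_fin _ e0 (x := x).
  by rewrite x0 ltW.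
pose y := Num.min (tau w) (x + r / 2).
have xy : x < y by rewrite lt_min xt ltrDl divr_gt0.
have yt : y <= tau w by rewrite ge_min lexx.
have y0 : 0 <= y := le_trans x0 (ltW xy).
have My := after_passage_time xy yt.
have := cont y; rewrite y0 yt => /(_ isT).
rewrite distrC ger0_norm ?subr_ge0 ?ltW// ltrBlDl.
have -> : y < x + r.
  by rewrite gt_min ltrD2l ltr_pdivrMr// mulr_natr mulr2n ltrDl r0 orbT.
move=> /(_ isT); rewrite distrC ltr_norml => /andP[_]; rewrite ltrD2r.
by rewrite ltNge -lee_fin fineK ?fin// ltW.
Qed.

End finite_path.

End level.

Lemma le_passage_time (u v : R) (w : Omega) : 0 <= u -> u <= v ->
  passage_time u w <= passage_time v w.
Proof.
move=> u0 uv; apply: ge_sup => [|s [st Mu]].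
  by have [] := passage_time_has_sup u0 w.
apply: passage_time_ge => //; first exact: le_trans uv.
by apply: le_trans Mu _; rewrite lee_fin.
Qed.

(** The clock is at most [v] at the right end and at least [u] at the left end, unless the left end
    is already [tau] and the interval is empty. *)
Lemma integral_between_passage_times (u v : R) (w : Omega) :
  0 <= u -> u <= v -> (time_integral M (tau w) w < +oo)%E ->
  (\int[@lebesgue_measure R]_(s in `]passage_time u w, passage_time v w])
     (M s w)%:E <= (v - u)%:E)%E.
Proof.
move=> u0 uv Mfin; have v0 := le_trans u0 uv.
have [ut|tu] := ltP (passage_time u w) (tau w); last first.
  rewrite set_itv_ge ?integral_set0 ?lee_fin ?subr_ge0//.
  by rewrite bnd_simp -leNgt; apply: le_trans tu; exact: passage_time_le.
have := time_integral_passage_time_le v0 Mfin.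
rewrite (time_integral_split M_process _ (passage_time_ge0 u0 w)
  (le_passage_time w u0 uv)); last first.
  by apply: le_lt_trans (tau_lt_T w); exact: passage_time_le.
rewrite -leeBrDl
  ?(time_integral_fin_num M_process _ _ (tau_lt_T w) Mfin)//; last 2 first.
- exact: passage_time_ge0.
- exact: ltW.
move=> /le_trans; apply; rewrite EFinB leeB//.
exact: le_time_integral_passage_time.
Qed.

End first_passage.

Lemma measurable_stopping_time {R : realType} {d : measure_display}
    {Omega : measurableType d} {F : R -> set (set Omega)} (sigma : Omega -> R) :
  filtration F -> stopping_time F sigma -> measurable_fun setT sigma.
Proof.
move=> F_filtration [sigma0 sigmaF] mT.
apply: (measurability _ (RGenOInfty.measurableE R)) => //.
move=> _ [_ [x ->] <-]; rewrite setTI.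
rewrite (_ : _ @^-1` _ = ~` [set w | sigma w <= x]); last first.
  by apply/seteqP; split => w /=; rewrite in_itv/= andbT ltNge => /negP.
(* The filtration is constrained only at times [x >= 0]; for negative [x] the event is empty. *)
apply: measurableC; have [x0|x0] := leP 0 x.
  exact: (filtration_measurable F_filtration x0 (sigmaF x x0)).
rewrite (_ : [set w | _] = set0)//; apply/seteqP; split => w //= sx.
by have := le_lt_trans (le_trans (sigma0 w) sx) x0; rewrite ltxx.
Qed.

(** * The product process and the passage from one level to the next *)

Section product_process.
Context {R : realType} {d : measure_display} {Omega : measurableType d}
  {F : R -> set (set Omega)} {T : R} {M X : R -> Omega -> R}.
Hypotheses (F_filtration : filtration F)
  (M_process : nonneg_adapted_process F T M)
  (X_process : nonneg_adapted_process F T X).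

Lemma nonneg_adapted_process_mul :
  nonneg_adapted_process F T (fun s w => M s w * X s w).
Proof.
split.
- move=> t w t0 tT.
  by rewrite mulr_ge0// (process_ge0 M_process, process_ge0 X_process).
- exact: measurable_funM (process_measurable M_process) (process_measurable X_process).
- move=> t t0 tT B mB; have Ft := filtration_sigma_algebra F_filtration t0.
  have mt Z : nonneg_adapted_process F T Z ->
      measurable_fun setT (Z t : g_sigma_algebraType (F t) -> R).
    move=> Z_process _ C mC; rewrite setTI measurable_g_measurableTypeE//.
    exact: (process_adapted Z_process).
  have := measurable_funM (mt _ M_process) (mt _ X_process) measurableT mB.
  by rewrite setTI measurable_g_measurableTypeE.
Qed.

Lemma running_sup_ge0 (t : R) (w : Omega) : 0 <= t -> t < T ->
  (0 <= running_sup X t w)%E.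
Proof.
move=> t0 tT; apply: (@le_trans _ _ (X 0 w)%:E).
  by rewrite lee_fin (process_ge0 X_process)// (le_lt_trans t0).
by apply: ereal_sup_ubound; exists 0 => //=; rewrite in_itv/= lexx.
Qed.

(** The part up to [s] vanishes, and on []s, t]] the factor [X] is at most its running supremum,
    which comes out of the integral of [M]. *)
Lemma time_integral_mul_le (s t e : R) (w : Omega) :
  0 <= s -> s <= t -> t < T -> 0 < e ->
  (\int[@lebesgue_measure R]_(r in `]s, t]) (M r w)%:E <= e%:E)%E ->
  time_integral (fun r w => M r w * X r w) s w = 0%E ->
  (time_integral (fun r w => (M r w * X r w)%R) t w <= e%:E * running_sup X t w)%E.
Proof.
move=> s0 st tT e0 Me Zs; have t0 := le_trans s0 st.
rewrite (time_integral_split nonneg_adapted_process_mul _ s0 st tT) Zs add0e.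
have in_st r : `]s, t]%classic r -> 0 <= r < T.
  rewrite /= in_itv/= => /andP[sr rt].
  by rewrite (le_trans s0 (ltW sr)) (le_lt_trans rt).
have mpath Z : nonneg_adapted_process F T Z -> measurable_fun `]s, t] (Z ^~ w).
  move=> Z_process.
  apply: measurable_funS (process_path_measurable Z_process w tT) => //.
  by move=> r /=; rewrite !in_itv/= => /andP[sr ->]; rewrite (le_trans s0 (ltW sr)).
have := running_sup_ge0 w t0 tT.
case S : (running_sup X t w) => [x| |]//; last by rewrite gt0_muley ?leey// lte_fin.
rewrite lee_fin => x0.
apply: (@le_trans _ _
  (\int[@lebesgue_measure R]_(r in `]s, t]) (x%:E * (M r w)%:E))%E).
  apply: ge0_le_integral => //.
  - move=> r /in_st/andP[r0 rT].
    by rewrite lee_fin (process_ge0 nonneg_adapted_process_mul).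
  - by apply/measurable_EFinP; exact: mpath nonneg_adapted_process_mul.
  - apply/measurable_EFinP; apply: measurable_funM => //; exact: mpath.
  - move=> r rst; have /andP[r0 rT] := in_st _ rst.
    rewrite -EFinM lee_fin mulrC ler_wpM2r//; first exact: (process_ge0 M_process).
    rewrite -lee_fin -S; apply: ereal_sup_ubound; exists r => //=.
    by move: rst; rewrite /= !in_itv/= r0 => /andP[].
rewrite ge0_integralZl//.
- by rewrite muleC lee_wpmul2r.
- by apply/measurable_EFinP; exact: mpath.
- by move=> r /in_st/andP[r0 rT]; rewrite lee_fin (process_ge0 M_process).
Qed.

Local Notation MX := (fun s w => M s w * X s w).

(** The expectation [E] up to [sigma2] satisfies [E <= e C E <= E / 2]. Being finite and nonnegative
    it is zero, so the nonnegative integrand vanishes almost surely. *)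
Lemma time_integral_mul_eq0_step (P : probability Omega R)
    (sigma1 sigma2 : Omega -> R) (C e : R) :
  measurable_fun setT sigma2 ->
  (forall w, 0 <= sigma1 w <= sigma2 w) -> (forall w, sigma2 w < T) ->
  0 < e -> e * C <= 2^-1 ->
  (\int[P]_w time_integral MX (sigma2 w) w < +oo)%E ->
  (\int[P]_w running_sup X (sigma2 w) w <=
     C%:E * \int[P]_w time_integral MX (sigma2 w) w)%E ->
  {ae P, forall w, time_integral MX (sigma1 w) w = 0%E} ->
  {ae P, forall w, (\int[@lebesgue_measure R]_(r in `]sigma1 w, sigma2 w])
    (M r w)%:E <= e%:E)%E} ->
  {ae P, forall w, time_integral MX (sigma2 w) w = 0%E}.
Proof.
move=> msigma2 sigma12 sigma2T e0 eC MX_fin sup_le MX0 M_le.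
have sigma2_ge0 w : 0 <= sigma2 w by have /andP[/le_trans] := sigma12 w; apply.
have MX_process := nonneg_adapted_process_mul.
have MX_ge0 w : (0 <= time_integral MX (sigma2 w) w)%E.
  exact: (time_integral_ge0 MX_process).
have sup_ge0 w := running_sup_ge0 w (sigma2_ge0 w) (sigma2T w).
have mMX : measurable_fun setT (fun w => time_integral MX (sigma2 w) w).
  apply: (measurable_time_integral MX_process) => // w.
  by rewrite sigma2_ge0 sigma2T.
set E := (\int[P]_w time_integral MX (sigma2 w) w)%E in MX_fin sup_le.
have E0 : (0 <= E)%E by exact: integral_ge0.
have Efin : E \is a fin_num by rewrite ge0_fin_numE.
(* The pathwise bound is integrated and [e] taken out by the lower integral lemmas, as the running
   supremum may fail to be measurable. *)
have E_le : (E <= e%:E * (C%:E * E))%E.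
  apply: le_trans (lee_wpmul2l _ sup_le); last by rewrite lee_fin ltW.
  apply: le_trans (lower_integralZl P e0 sup_ge0).
  apply: ae_ge0_le_lower_integral => //.
    by move=> w; rewrite mule_ge0// lee_fin ltW.
  apply: filterS2 MX0 M_le => w MX0w Mw.
  have /andP[s10 s12] := sigma12 w.
  exact: (time_integral_mul_le s10 s12 (sigma2T w) e0 Mw MX0w).
have E_eq0 : E = 0%E.
  move: E_le E0; rewrite -(fineK Efin) -!EFinM !lee_fin mulrA => E_le E0.
  have := ler_wpM2r E0 eC => E_le'.
  by congr EFin; lra.
have /(ae_eq_integral_abs P measurableT mMX) :
    (\int[P]_w `|time_integral MX (sigma2 w) w| = 0)%E.
  by rewrite -E_eq0; apply: eq_integral => w _; rewrite gee0_abs.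
by apply: filterS => w /(_ I).
Qed.

End product_process.

(** * Induction over the levels and conclusion *)

Theorem lemma5p11 (R : realType) (d : measure_display)
    (Omega : measurableType d) (P : probability Omega R)
    (F : R -> set (set Omega))
    (F_filtration : filtration F)
    (F_complete : complete_filtration P F)
    (F_right_continuous : right_continuous_filtration F)
    (T : R) (T_gt0 : 0 < T)
    (X Y M : R -> Omega -> R)
    (X_process : nonneg_adapted_process F T X)
    (Y_process : nonneg_adapted_process F T Y)
    (M_process : nonneg_adapted_process F T M)
    (X0 : {ae P, forall w, X 0 w = 0})
    (tau : Omega -> R)
    (tau_stopping : stopping_time F tau)
    (tau_lt_T : forall w, tau w < T)
    (MX_integrable :
      (\int[P]_w time_integral (fun s w => (M s w * X s w)%R) (tau w) w
        < +oo)%E)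
    (kappa : R)
    (M_bound : {ae P, forall w, (time_integral M (tau w) w < kappa%:E)%E})
    (C0 : R)
    (hC0 : forall tau_b : Omega -> R,
      stopping_time F tau_b -> (forall w, tau_b w <= tau w) ->
      (\int[P]_w (running_sup X (tau_b w) w + time_integral Y (tau_b w) w)
        <= C0%:E *
           \int[P]_w ((X 0%R w)%:E +
             time_integral (fun s w => (M s w * X s w)%R) (tau_b w) w))%E) :
  (\int[P]_w running_sup X (tau w) w = \int[P]_w time_integral Y (tau w) w /\
   \int[P]_w time_integral Y (tau w) w = 0)%E.
Proof.
have MX_process := nonneg_adapted_process_mul F_filtration M_process X_process.
set MX := fun s w => M s w * X s w in MX_process MX_integrable hC0.
have tau0 w : 0 <= tau w by have [] := tau_stopping.
have X0_ge0 w : 0 <= X 0 w by exact: (process_ge0 X_process).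
have MX_ge0 sigma w : sigma w <= tau w -> (0 <= time_integral MX (sigma w) w)%E.
  by move=> st; apply: (time_integral_ge0 MX_process); exact: le_lt_trans (tau_lt_T w).
have Y_ge0 sigma w : sigma w <= tau w -> (0 <= time_integral Y (sigma w) w)%E.
  by move=> st; apply: (time_integral_ge0 Y_process); exact: le_lt_trans (tau_lt_T w).
have sup_ge0 sigma w : 0 <= sigma w -> sigma w <= tau w ->
    (0 <= running_sup X (sigma w) w)%E.
  by move=> s0 st; apply: (running_sup_ge0 X_process) => //;
    exact: le_lt_trans (tau_lt_T w).
(* A positive constant can be inverted below; enlarging [C0] preserves the estimate because the
   expectation it multiplies is nonnegative. *)
pose C := Num.max C0 1.
have C_gt0 : 0 < C by rewrite lt_max ltr01 orbT.
have sup_le sigma : stopping_time F sigma -> (forall w, sigma w <= tau w) ->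
    (\int[P]_w running_sup X (sigma w) w <=
      C%:E * \int[P]_w time_integral MX (sigma w) w)%E.
  move=> sigma_stopping st; have [sigma0 _] := sigma_stopping.
  apply: (@le_trans _ _
    (\int[P]_w (running_sup X (sigma w) w + time_integral Y (sigma w) w))%E).
    apply: ae_ge0_le_lower_integral => [w|w|].
    - exact: sup_ge0.
    - by rewrite adde_ge0 ?sup_ge0 ?Y_ge0.
    - by apply: aeW => w; rewrite leeDl ?Y_ge0.
  apply: le_trans (hC0 _ sigma_stopping st) _.
  apply: (@le_trans _ _
    (C%:E * \int[P]_w ((X 0 w)%:E + time_integral MX (sigma w) w))%E).
    apply: lee_wpmul2r; last by rewrite lee_fin le_max lexx.
    by apply: integral_ge0 => w _; rewrite adde_ge0 ?lee_fin ?MX_ge0.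
  apply: lee_wpmul2l; first by rewrite lee_fin ltW.
  apply: ae_ge0_le_lower_integral => [w|w|].
  - by rewrite adde_ge0 ?lee_fin ?MX_ge0.
  - exact: MX_ge0.
  - by apply: filterS X0 => w ->; rewrite add0e.
(* Chosen so that [e * C = 1 / 2], the factor absorbed in each step. *)
pose e := (2 * C)^-1.
have e0 : 0 < e by rewrite invr_gt0 mulr_gt0.
have eC : e * C <= 2^-1 by rewrite /e invfM -mulrA mulVf ?gt_eqF// mulr1.
have M_fin : {ae P, forall w, (time_integral M (tau w) w < +oo)%E}.
  by apply: filterS M_bound => w /lt_trans; apply; rewrite ltry.
pose sigma (k : nat) := passage_time (M := M) (tau := tau) (k%:R * e).
have level_ge0 k : 0 <= k%:R * e by rewrite mulr_ge0// ltW.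
have sigma_stopping k : stopping_time F (sigma k).
  exact: (passage_time_stopping M_process tau_stopping tau_lt_T (level_ge0 k)
    F_filtration F_right_continuous F_complete).
have sigma_le k w : sigma k w <= tau w by exact: (passage_time_le tau_stopping).
have sigma_ge0 k w : 0 <= sigma k w by exact: (passage_time_ge0 tau_stopping).
have MX_fin k : (\int[P]_w time_integral MX (sigma k w) w < +oo)%E.
  apply: le_lt_trans MX_integrable; apply: ae_ge0_le_lower_integral => [w|w|].
  - exact: MX_ge0.
  - exact: MX_ge0.
  - by apply: aeW => w; exact: (le_time_integral MX_process).
have step (s1 : Omega -> R) k : (forall w, 0 <= s1 w <= sigma k w) ->
    {ae P, forall w, time_integral MX (s1 w) w = 0%E} ->
    {ae P, forall w, (\int[@lebesgue_measure R]_(r in `]s1 w, sigma k w])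
      (M r w)%:E <= e%:E)%E} ->
    {ae P, forall w, time_integral MX (sigma k w) w = 0%E}.
  move=> s1k;
  apply: (time_integral_mul_eq0_step F_filtration M_process X_process) e0 eC _ _ => //.
  - exact: measurable_stopping_time F_filtration (sigma_stopping k).
  - by move=> w; exact: le_lt_trans (tau_lt_T w).
  - exact: sup_le.
have MX0 k : {ae P, forall w, time_integral MX (sigma k w) w = 0%E}.
  elim: k => [|k IH].
    (* The induction starts from the constant time [0]. Since [sigma 0] belongs to level [0], the
       clock is still zero there and the bound by [e] holds. *)
    apply: (step (cst 0)) => [w||].
    - by rewrite lexx sigma_ge0.
    - by apply: aeW => w; exact: time_integral0.
    - apply: filterS M_fin => w Mw.
      have :=
        time_integral_passage_time_le M_process tau_stopping tau_lt_T (level_ge0 0) Mw.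
      rewrite (time_integral_split M_process _ (lexx 0) (sigma_ge0 0 w)); last first.
        exact: le_lt_trans (tau_lt_T w).
      rewrite time_integral0 add0e => /le_trans; apply.
      by rewrite mul0r lee_fin ltW.
  have kS : k%:R * e <= k.+1%:R * e by rewrite ler_pM2r// ler_nat.
  apply: (step (sigma k)) => // [w|].
    by rewrite sigma_ge0 (le_passage_time tau_stopping).
  apply: filterS M_fin => w Mw.
  have := integral_between_passage_times
    M_process tau_stopping tau_lt_T (level_ge0 k) kS Mw.
  by rewrite -mulrBl -natrB// subSnn mul1r.
have MX_tau : {ae P, forall w, time_integral MX (tau w) w = 0%E}.
  (* Once [k e >= kappa], the clock stays below level [k e] up to [tau] almost surely, so [sigma k]
     equals [tau]. *)
  have [k /=] := filter_ex (nbhs_infty_ger (kappa / e)).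
  rewrite ler_pdivrMr// => kappak.
  apply: filterS2 M_bound (MX0 k) => w Mw.
  suff -> : sigma k w = tau w by [].
  apply/eqP; rewrite eq_le sigma_le; apply: (passage_time_ge tau_stopping) => //.
    by rewrite tau0 lexx.
  by apply: le_trans (ltW Mw) _; rewrite lee_fin.
(* The hypothesis is used at [tau] itself: the expectation on its right is now zero, and so is its
   product with [C0], whatever the sign of [C0]. *)
have sumXY_le0 :
    (\int[P]_w (running_sup X (tau w) w + time_integral Y (tau w) w) <= 0)%E.
  apply: le_trans (hC0 tau tau_stopping (fun w => lexx (tau w))) _.
  rewrite (_ : (\int[P]_w _ = 0)%E) ?mule0//.
  apply/eqP; rewrite eq_le; apply/andP; split.
    rewrite -[leRHS](integral0 P setT); apply: ae_ge0_le_lower_integral => [w|//|].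
      by rewrite adde_ge0 ?lee_fin ?MX_ge0.
    by apply: filterS2 X0 MX_tau => w -> ->; rewrite add0e.
  by apply: integral_ge0 => w _; rewrite adde_ge0 ?lee_fin ?MX_ge0.
have sup_tau_ge0 w := sup_ge0 tau w (tau0 w) (lexx _).
have Y_tau_ge0 w := Y_ge0 tau w (lexx _).
(* Each summand is compared with the whole sum by monotonicity, which avoids additivity for a
   possibly non-measurable supremum. *)
have Y_eq0 : (\int[P]_w time_integral Y (tau w) w = 0)%E.
  apply/eqP; rewrite eq_le integral_ge0// andbT; apply: le_trans sumXY_le0.
  apply: ae_ge0_le_lower_integral => [//|w|]; first by rewrite adde_ge0.
  by apply: aeW => w; rewrite leeDr.
split=> //; rewrite Y_eq0.
apply/eqP; rewrite eq_le integral_ge0// andbT; apply: le_trans sumXY_le0.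
apply: ae_ge0_le_lower_integral => [//|w|]; first by rewrite adde_ge0.
by apply: aeW => w; rewrite leeDl.
Qed.
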